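(* Let $K\subset\mathbb{R}^n$ be a body and let $\mathcal{E}\subset\mathbb{R}^n$ be an ellipsoid. Then $u_K(\mathcal{E})=\mathcal{E}$ if and only if $\mathcal{E}$ is the Löwner-John ellipsoid of $K$.
   Context: A body in $\mathbb{R}^n$ is a compact convex set $K$ with $K=-K$ and non-empty interior; $\|x\|_K=\inf\{\lambda>0: x\in\lambda K\}$ is the norm with unit ball $K$. An ellipsoid means a centrally-symmetric (centered at the origin), non-degenerate ellipsoid. The Löwner-John ellipsoid of $K$ is the (unique) ellipsoid of maximal volume contained in $K$. For an ellipsoid $\mathcal{E}$, $\langle\cdot,\cdot\rangle_{\mathcal{E}}$ is the unique scalar product on $\mathbb{R}^n$ with $\mathcal{E}=\{x:\langle x,x\rangle_{\mathcal{E}}\le 1\}$, and $\mu_{\mathcal{E}}$ is the unique Borel probability measure on $\partial\mathcal{E}$ invariant under all linear isometries of $(\mathbb{R}^n,\langle\cdot,\cdot\rangle_{\mathcal{E}})$. For a body $K$, $M_{\mathcal{E}}(K)=\left(\int_{\partial\mathcal{E}}\|x\|_K^2\,d\mu_{\mathcal{E}}(x)\right)^{1/2}$. For a body $K$ and an ellipsoid $\mathcal{E}$, $u_K(\mathcal{E})$ denotes the unique ellipsoid contained in $K$ at which the infimum $J_K(\mathcal{E})=\inf\{M_{\mathcal{E}}(\mathcal{F}):\mathcal{F}\subset K\text{ an ellipsoid}\}$ is attained (such an ellipsoid exists and is unique). *)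

(* Defs.v *)
From HB Require Import structures.
From mathcomp Require Import all_boot all_order all_algebra.
From mathcomp Require Import all_classical all_reals all_analysis.

Set Implicit Arguments.
Unset Strict Implicit.
Unset Printing Implicit Defensive.

Import Order.TTheory GRing.Theory Num.Theory.
Import numFieldNormedType.Exports.

Local Open Scope classical_set_scope.
Local Open Scope ring_scope.

(* R^n with its Borel sigma-algebra *)
Notation borel_rV R n := (g_sigma_algebraType (@open 'rV[R]_n)).

Section Bodies.
Context {R : realType} {n : nat}.
Local Notation V := 'rV[R]_n.

Definition body (K : set V) : Prop :=
  [/\ compact K, convex_set K, K = [set - x | x in K] & K° !=set0].

Definition gauge (K : set V) (x : V) : R :=
  inf [set l | 0 < l /\ [set l *: y | y in K] x].

(* With theta := idfun, [{dot V for theta}] is the type of symmetric positive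
   definite bilinear forms, i.e. of all scalar products on R^n. *)
Definition unit_ball_of (ip : {dot V for idfun}) : set V :=
  [set x | ip x x <= 1].

Definition ellipsoid (E : set V) : Prop :=
  exists ip : {dot V for idfun}, E = unit_ball_of ip.

Definition boundary (E : set V) : set V := closure E `\` E°.

(* This property characterizes mu_E. A Borel probability measure on the boundary
   of E is encoded as one on R^n that gives this boundary mass 1. For an
   ellipsoid E the form ip below exists and is unique: it is <.,.>_E. *)
Definition invariant_probability (E : set V)
    (mu : probability (borel_rV R n) R) : Prop :=
  mu (boundary E) = 1%E /\
  forall ip : {dot V for idfun}, E = unit_ball_of ip ->
  forall g : {linear V -> V}, isometry ip ip g ->
  forall A : set (borel_rV R n), measurable A -> mu (g @^-1` A) = mu A.

(* M_E(K), with mu = mu_E *)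
Definition Mnorm (E : set V) (mu : probability (borel_rV R n) R) (K : set V) : R :=
  Num.sqrt (\int[mu]_(x in boundary E) (gauge K x ^+ 2)).

Definition Jinf (K E : set V) (mu : probability (borel_rV R n) R) : R :=
  inf [set Mnorm E mu F | F in [set F | ellipsoid F /\ F `<=` K]].

(* [xget set0 P] is "the" set satisfying P; its default value, the empty set, is
   not an ellipsoid. *)
Definition u_map (K E : set V) (mu : probability (borel_rV R n) R) : set V :=
  xget set0
    [set F | [/\ ellipsoid F, F `<=` K & Mnorm E mu F = Jinf K E mu]].

Definition box (a b : V) : set V :=
  [set x | forall i, a 0 i <= x 0 i <= b 0 i].

(* n-dimensional Lebesgue (outer) measure: infimum of the total volumes of the
   countable coverings by boxes. *)
Definition volume (A : set V) : \bar R :=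
  ereal_inf [set s | exists a b : nat -> V,
    [/\ forall k i, a k 0 i <= b k 0 i,
        A `<=` \bigcup_k box (a k) (b k) &
        s = (\sum_(0 <= k <oo) (\prod_i (b k 0 i - a k 0 i))%:E)%E]].

Definition lowner_john (K : set V) : set V :=
  xget set0
    [set E | [/\ ellipsoid E, E `<=` K &
      forall F, ellipsoid F -> F `<=` K -> (volume F <= volume E)%E]].

End Bodies.

(* Main.v *)
From HB Require Import structures.
Require Import Defs.
From mathcomp Require Import all_boot all_order all_algebra.
From mathcomp Require Import all_classical all_reals all_analysis.
From mathcomp Require Import measurable_realfun ring lra.
Import numFieldNormedType.Exports.

(** Write an ellipsoid as [{x | x A x^T <= 1}] with A symmetric positive definite, and
    let A0 be the matrix of E and T such that T A0 T^T = 1. Signed permutations in an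
    E-orthonormal basis preserve mu_E, so its second moments in this basis are those of
    1/n times the identity, and n M_E(F)^2 = tr (T A T^T) for the ellipsoid F of A; its
    volume is proportional to (det A)^(-1/2).
    By AM-GM a positive definite B with tr B <= n and det B >= 1 is the identity. If E
    has maximal volume in K, this applied to B = T A T^T shows that E is the unique
    minimizer of M_E. Conversely, the inverses of the matrices of the ellipsoids
    contained in K form a convex set; if E minimizes M_E, then the derivative of
    tr B^-1 at the identity in the direction of B - 1, where B^-1 = T A T^T, gives
    tr B <= n, so that det A <= det A0 forces A = A0. *)

Set Implicit Arguments.
Unset Strict Implicit.
Unset Printing Implicit Defensive.

Import Order.TTheory GRing.Theory Num.Theory.

Local Open Scope classical_set_scope.
Local Open Scope ring_scope.

(** * Positive definite matrices *)

Section QuadraticForms.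
Context {R : rcfType} {n : nat}.
Implicit Types (A B S T : 'M[R]_n) (x y : 'rV[R]_n).

Definition qf A x : R := (x *m A *m x^T) 0 0.

Definition posdef A := A^T = A /\ forall x, x != 0 -> 0 < qf A x.

Lemma qf1 x : qf 1%:M x = \sum_i x 0 i ^+ 2.
Proof.
by rewrite /qf mulmx1 mxE; apply: eq_bigr => i _; rewrite mxE expr2.
Qed.

Lemma qf_congr A S x : qf (S *m A *m S^T) x = qf A (x *m S).
Proof. by rewrite /qf trmx_mul !mulmxA. Qed.

Lemma qf0 A : qf A 0 = 0.
Proof. by rewrite /qf !mul0mx mxE. Qed.

Lemma qfZ A c x : qf A (c *: x) = c ^+ 2 * qf A x.
Proof. by rewrite /qf -!scalemxAl linearZ /= -scalemxAr !mxE mulrA expr2. Qed.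

Lemma qfD A B x : qf (A + B) x = qf A x + qf B x.
Proof. by rewrite /qf mulmxDr mulmxDl !mxE. Qed.

Lemma qf_scale A c x : qf (c *: A) x = c * qf A x.
Proof. by rewrite /qf -scalemxAr -scalemxAl !mxE. Qed.

Lemma qf_delta A i : qf A (delta_mx 0 i) = A i i.
Proof. by rewrite /qf -rowE trmx_delta -colE !mxE. Qed.

Lemma posdef_ge0 A x : posdef A -> 0 <= qf A x.
Proof.
move=> [_ hA]; have [->|/hA/ltW//] := eqVneq x 0; by rewrite qf0.
Qed.

Lemma posdef_unit A : posdef A -> A \in unitmx.
Proof.
move=> [_ hA]; rewrite -row_free_unit -kermx_eq0; apply/eqP/row_matrixP => i.
rewrite row0; apply/eqP; apply: contraT => /hA.
rewrite /qf; have /sub_kermxP -> : (row i (kermx A) <= kermx A)%MS by apply: row_sub.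
by rewrite mul0mx mxE ltxx.
Qed.

Lemma posdef_congr A S : S \in unitmx -> posdef A -> posdef (S *m A *m S^T).
Proof.
move=> uS [sA hA]; split; first by rewrite !trmx_mul trmxK sA mulmxA.
move=> x x0; rewrite qf_congr hA//; apply: contra x0 => /eqP h.
by rewrite -(mulmxK uS x) h mul0mx.
Qed.

Lemma posdef_inv A : posdef A -> posdef (invmx A).
Proof.
move=> pA; have uA := posdef_unit pA; have [sA _] := pA.
have -> : invmx A = invmx A *m A *m (invmx A)^T.
  by rewrite mulVmx// mul1mx trmx_inv sA.
by apply: posdef_congr => //; rewrite unitmx_inv.
Qed.

Lemma posdef1 : posdef 1%:M.
Proof.
split=> [|x x0]; first by rewrite trmx1.
rewrite qf1 lt_neqAle sumr_ge0 ?andbT => [|i _]; last by rewrite sqr_ge0.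
apply: contra x0; rewrite eq_sym psumr_eq0 => [/allP h|i _]; last by rewrite sqr_ge0.
by apply/eqP/rowP => i; rewrite mxE; apply/eqP; rewrite -sqrf_eq0; exact: h (mem_index_enum i).
Qed.

Lemma posdef_conv A B t : 0 < t < 1 -> posdef A -> posdef B ->
  posdef ((1 - t) *: A + t *: B).
Proof.
move=> /andP[t0 t1] [sA hA] [sB hB]; split; first by rewrite linearD !linearZ /= sA sB.
move=> x x0; rewrite qfD !qf_scale addr_gt0// mulr_gt0 ?subr_gt0 ?hA ?hB//.
Qed.

Lemma posdef_diag_gt0 A i : posdef A -> 0 < A i i.
Proof.
move=> [_ hA]; rewrite -qf_delta hA//; apply/eqP => /rowP/(_ i)/eqP.
by rewrite !mxE !eqxx oner_eq0.
Qed.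

(** On row vectors this map adds the linear form [x *m v] to coordinate [k]. It is a shear in the
    strict sense when [v k 0 = 0]. *)
Definition shear (k : 'I_n) (v : 'cV[R]_n) : 'M[R]_n := 1%:M + v *m delta_mx 0 k.

Lemma mul_shearE k v x j : (x *m shear k v) 0 j =
  x 0 j + (x *m v) 0 0 * (j == k)%:R.
Proof.
rewrite mulmxDr mulmx1 mulmxA [LHS]mxE; congr (_ + _).
by rewrite [LHS]mxE big_ord1 [X in _ * X]mxE eqxx.
Qed.

(** The cross term contains the factor [delta_mx 0 k *m v], which is the entry [v k 0]. *)
Lemma shearD k (v w : 'cV[R]_n) : v k 0 = 0 -> shear k w *m shear k v = shear k (v + w).
Proof.
move=> v0; rewrite /shear mulmxDr mulmx1 !mulmxDl !mul1mx.
have -> : w *m delta_mx 0 k *m (v *m delta_mx 0 k) = 0 :> 'M[R]_n.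
  rewrite mulmxA -(mulmxA w) -rowE.
  have -> : row k v = 0 by apply/rowP => i; rewrite !mxE (ord1 i) v0.
  by rewrite mulmx0 mul0mx.
by rewrite addr0 -addrA [w *m _ + _]addrC.
Qed.

Lemma shear0 k : shear k 0 = 1%:M.
Proof. by rewrite /shear mul0mx addr0. Qed.

Lemma shear_entry k (v : 'cV[R]_n) i j : shear k v i j = (i == j)%:R + v i 0 * (j == k)%:R.
Proof. by rewrite !mxE big_ord1 !mxE eqxx. Qed.

Lemma shear_congr_entry A k (v : 'cV[R]_n) i j : A^T = A ->
  (shear k v *m A *m (shear k v)^T) i j =
  A i j + v i 0 * A k j + A k i * v j 0 + v i 0 * A k k * v j 0.
Proof.
move=> sA; have sym a b : A a b = A b a by rewrite -{1}sA mxE.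
have e1 (B : 'M[R]_n) a b : (shear k v *m B) a b = B a b + v a 0 * B k b.
  rewrite /shear mulmxDl mul1mx -mulmxA -rowE [LHS]mxE; congr (_ + _).
  by rewrite mxE big_ord1 mxE.
rewrite -[_ *m _ *m _]trmxK trmx_mul trmxK mxE e1 !mxE.
have e2 a b : (shear k v *m A)^T a b = A b a + v b 0 * A k a by rewrite mxE e1.
move: (e1 A i j) (e1 A i k); rewrite !mxE => -> ->.
by rewrite (sym i k); ring.
Qed.

End QuadraticForms.

(** * Symmetric Gaussian elimination by shears *)

Section Diagonalization.
Context {R : rcfType} {n : nat}.
Implicit Types (A B S T : 'M[R]_n) (x y : 'rV[R]_n).

(** Row [k] is a unit vector, and deleting row and column [k] leaves an identity matrix. *)
Lemma det_shear k (v : 'cV[R]_n) : v k 0 = 0 -> \det (shear k v) = 1.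
Proof.
move=> vk; rewrite (expand_det_row _ k) (bigD1 k)//= big1 ?addr0 => [|j jk].
  rewrite shear_entry vk mul0r eqxx addr0 mul1r /cofactor addnn -signr_odd odd_double mul1r.
  rewrite -[RHS](det1 R n.-1); congr (\det _); apply/matrixP => i j.
  have kl (m : 'I_n.-1) : lift k m == k = false.
    by rewrite eq_sym; apply/negbTE/neq_lift.
  by rewrite 2!mxE shear_entry kl mulr0 addr0 mxE (inj_eq lift_inj).
by rewrite shear_entry vk mul0r addr0 eq_sym (negbTE jk) mul0r.
Qed.

(** Symmetric elimination: a shear clears row and column [k] and lowers the trace by the pivot times
    the squared length of [v], so the trace is kept only if nothing had to be cleared. The predicate
    [P] records what shears have in common; it is trivial in the algebraic uses and is preservation
    of volume for ellipsoids. *)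
Lemma posdef_shear_diag (P : 'M[R]_n -> Prop) A : P 1%:M ->
  (forall S T, P S -> P T -> P (S *m T)) ->
  (forall k (v : 'cV_n), v k 0 = 0 -> P (shear k v)) -> posdef A ->
  exists S (d : 'rV[R]_n), [/\ P S, \det S = 1, S *m A *m S^T = diag_mx d,
    \sum_i d 0 i <= \tr A & \sum_i d 0 i = \tr A -> A = diag_mx d].
Proof.
move=> P1 PM Psh pA.
(* After [m] rounds the first [m] rows vanish off the diagonal. *)
suff /(_ n (leqnn n)) [S [PS dS dg tr eq]] : forall m, (m <= n)%N -> exists S,
   let A' := S *m A *m S^T in
   [/\ P S, \det S = 1, (forall i j : 'I_n, (i < m)%N -> i != j -> A' i j = 0),
       \tr A' <= \tr A & \tr A' = \tr A -> A' = A].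
  set A' := S *m A *m S^T in dg tr eq.
  have e : A' = diag_mx (\row_i A' i i).
    apply/matrixP => i j; rewrite [RHS]mxE [X in X *+ _]mxE.
    by have [->//|ij] := eqVneq i j; rewrite mulr0n dg.
  exists S, (\row_i A' i i); split => //; under eq_bigr do rewrite mxE; first exact: tr.
  by move=> /eq <-.
elim=> [_|m IH mn].
  by exists 1%:M; rewrite /= mul1mx trmx1 mulmx1 det1; split.
have [S [PS dS dg tr eq]] := IH (ltnW mn).
set A1 := S *m A *m S^T in dg tr eq.
have uS : S \in unitmx by rewrite unitmxE dS unitr1.
have pA1 : posdef A1 by exact: posdef_congr.
have [sA1 _] := pA1.
have sym a b : A1 a b = A1 b a by rewrite -{1}sA1 mxE.
pose k := Ordinal mn; have k0 := posdef_diag_gt0 k pA1.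
(* The coefficient [v j 0] is the one that cancels the entry [(j, k)] against the pivot. *)
pose v : 'cV[R]_n := \col_j (- (A1 j k / A1 k k) *+ (j != k)).
have vk : v k 0 = 0 by rewrite mxE eqxx.
have vj j : j != k -> v j 0 = - (A1 j k / A1 k k) by rewrite mxE => ->.
pose A2 := shear k v *m A1 *m (shear k v)^T.
have E i j : A2 i j =
   A1 i j + v i 0 * A1 k j + A1 k i * v j 0 + v i 0 * A1 k k * v j 0.
  by rewrite /A2 shear_congr_entry.
have A2E : shear k v *m S *m A *m (shear k v *m S)^T = A2.
  by rewrite /A2 /A1 trmx_mul !mulmxA.
have diagE i : A2 i i = A1 i i - A1 k k * v i 0 ^+ 2.
  rewrite E; have [->|ik] := eqVneq i k; first by rewrite vk; ring.
  by rewrite (vj _ ik) (sym i k); field; exact: lt0r_neq0.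
have trE : \tr A2 = \tr A1 - A1 k k * \sum_i v i 0 ^+ 2.
  by rewrite /mxtrace mulr_sumr -sumrB; apply: eq_bigr => i _; exact: diagE.
have v2 : 0 <= A1 k k * \sum_i v i 0 ^+ 2.
  by rewrite mulr_ge0 ?(ltW k0)// sumr_ge0// => i _; exact: sqr_ge0.
exists (shear k v *m S); rewrite /= A2E; split.
- by apply: PM => //; exact: Psh.
- by rewrite det_mulmx dS det_shear// mulr1.
- move=> i j; rewrite ltnS leq_eqVlt => /predU1P[im|im] ij.
    have -> : i = k by apply: val_inj.
    have jk : j != k by rewrite eq_sym; apply: contra ij => /eqP <-; apply/eqP/val_inj.
    by rewrite E vk (vj _ jk) (sym j k); field; exact: lt0r_neq0.
  (* Rows cleared earlier stay cleared, since [A1 i k = 0] also makes [v i 0] vanish. *)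
  have ik : i != k by apply/eqP => ik; rewrite ik ltnn in im.
  have Aik : A1 i k = 0 by apply: dg.
  by rewrite E (vj _ ik) Aik (sym k i) Aik dg//; ring.
- by rewrite trE lerBlDr (le_trans tr)// lerDl.
(* No round raises the trace, so equality makes both the earlier decrease and the present one
   zero. *)
- move=> t; have t1 : \tr A1 = \tr A.
    by apply/eqP; rewrite eq_le tr -t trE lerBlDr lerDl.
  have : A1 k k * \sum_i v i 0 ^+ 2 = 0 by move: t; rewrite trE t1; lra.
  move/eqP; rewrite mulf_eq0 (gt_eqF k0)/= psumr_eq0 => [/allP h|i _]; last exact: sqr_ge0.
  have v0 : v = 0.
    apply/colP => i; rewrite [RHS]mxE; apply/eqP.
    by rewrite -sqrf_eq0; exact: h (mem_index_enum i).
  by rewrite /A2 v0 shear0 mul1mx trmx1 mulmx1 eq.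
Qed.

Lemma posdef_det_gt0 A : posdef A -> 0 < \det A.
Proof.
move=> pA; have [S [d [_ dS e _ _]]] := @posdef_shear_diag (fun=> True) A I
  (fun _ _ _ _ => I) (fun _ _ _ => I) pA.
have pD : posdef (diag_mx d).
  by rewrite -e; apply: posdef_congr => //; rewrite unitmxE dS unitr1.
have : \det (S *m A *m S^T) = \det (diag_mx d) by rewrite e.
rewrite !det_mulmx det_tr dS mul1r mulr1 => ->.
rewrite det_diag prodr_gt0// => i _; have := posdef_diag_gt0 i pD.
by rewrite mxE eqxx.
Qed.

(* AM-GM for the pivots d of the elimination: their product is det A, their sum is at most tr A. *)
Lemma posdef_trace_det_eq1 A : posdef A -> \tr A <= n%:R -> 1 <= \det A -> A = 1%:M.
Proof.
move=> pA trA dA; have [S [d [_ dS e tr eq]]] := @posdef_shear_diag (fun=> True) A I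
  (fun _ _ _ _ => I) (fun _ _ _ => I) pA.
have pD : posdef (diag_mx d).
  by rewrite -e; apply: posdef_congr => //; rewrite unitmxE dS unitr1.
have d0 i : 0 < d 0 i by have := posdef_diag_gt0 i pD; rewrite mxE eqxx.
have dE : \det A = \prod_i d 0 i.
  by rewrite -det_diag -e !det_mulmx det_tr dS mul1r mulr1.
have := leif_AGM (fun i (_ : i \in 'I_n) => ltW (d0 i)).
have -> : \prod_(i in 'I_n) d 0 i = \prod_i d 0 i by apply: eq_bigl => i; rewrite inE.
have -> : \sum_(i in 'I_n) d 0 i = \sum_i d 0 i by apply: eq_bigl => i; rewrite inE.
rewrite card_ord -dE => -[le1 eq1].
(* In dimension 0 all matrices are equal; from here on division by [n] is allowed. *)
case: (posnP n) => [n0|n_gt0].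
  by apply/matrixP => i; suff: false by []; rewrite -(ltn0 i) -[X in (_ < X)%N]n0 ltn_ord.
have nR : 0 < n%:R :> R by rewrite ltr0n.
have s1 : (\sum_i d 0 i) / n%:R <= 1 by rewrite ler_pdivrMr// mul1r (le_trans tr).
have s0 : 0 <= (\sum_i d 0 i) / n%:R.
  by rewrite divr_ge0 ?ler0n// sumr_ge0// => i _; exact/ltW.
have sn1 : ((\sum_i d 0 i) / n%:R) ^+ n <= 1 by rewrite exprn_ile1.
(* The chain from 1 through [\det A] and the [n]-th power of the mean of [d] back to 1 collapses to
   equalities. *)
have d1 : \det A = 1 by apply/eqP; rewrite eq_le dA (le_trans le1).
have sn : ((\sum_i d 0 i) / n%:R) ^+ n = 1 by apply/eqP; rewrite eq_le sn1 -[X in X <= _]d1.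
have s : \sum_i d 0 i = n%:R.
  move/eqP: sn; rewrite pexpr_eq1// => /eqP/(canRL (divfK (lt0r_neq0 nR))) ->.
  by rewrite mul1r.
have eqA : A = diag_mx d by apply: eq; apply/eqP; rewrite eq_le tr s.
(* The equality case of AM-GM: all pivots coincide, hence equal their mean 1. *)
move: eq1; rewrite sn d1 eqxx => /esym/forallP dd.
have dc i j : d 0 i = d 0 j by have /implyP/(_ isT)/forallP/(_ j)/implyP/(_ isT)/eqP := dd i.
have di i : d 0 i = 1.
  have : \sum_j d 0 j = n%:R * d 0 i.
    under eq_bigr do rewrite (dc _ i).
    by rewrite sumr_const card_ord mulr_natl.
  by rewrite s => /esym/(canRL (mulKf (lt0r_neq0 nR))) ->; rewrite mulVf ?lt0r_neq0.
rewrite eqA; apply/matrixP => i j; rewrite !mxE di; by case: eqP.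
Qed.

(** The rows of [T] are an orthonormal basis for the form of [A]: elimination makes the basis
    orthogonal, and dividing by the square roots of the pivots normalizes it. *)
Lemma posdef_orthonormal A : posdef A ->
  exists T, T \in unitmx /\ T *m A *m T^T = 1%:M.
Proof.
move=> pA; have [S [d [_ dS e _ _]]] := @posdef_shear_diag (fun=> True) A I
  (fun _ _ _ _ => I) (fun _ _ _ => I) pA.
have uS : S \in unitmx by rewrite unitmxE dS unitr1.
have pD : posdef (diag_mx d) by rewrite -e; apply: posdef_congr.
have d0 i : 0 < d 0 i by have := posdef_diag_gt0 i pD; rewrite mxE eqxx.
pose r : 'rV[R]_n := \row_i (Num.sqrt (d 0 i))^-1.
exists (diag_mx r *m S); split.
  rewrite unitmx_mul uS andbT unitmxE det_diag unitfE; apply/prodf_neq0 => i _.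
  by rewrite mxE invr_eq0 sqrtr_eq0 -ltNge.
rewrite trmx_mul !mulmxA -2!(mulmxA (diag_mx r)) e tr_diag_mx.
rewrite mul_mx_diag mul_diag_mx; apply/matrixP => i j; rewrite !mxE.
have [->|ij] := eqVneq i j; last by rewrite mulr0 mul0r.
have s0 : Num.sqrt (d 0 j) != 0 by rewrite sqrtr_eq0 -ltNge.
move: (sqr_sqrtr (ltW (d0 j))) s0 => {3}<-; rewrite mulr1n; move: (Num.sqrt _ : R) => s s0.
by rewrite [RHS]/=; field.
Qed.

End Diagonalization.

(** * Trace and determinant over the ellipsoids contained in a convex set *)

Section Optimization.
Context {R : rcfType} {n : nat}.
Implicit Types (A B S T : 'M[R]_n) (x y : 'rV[R]_n) (K : set 'rV[R]_n).

Definition ellip A : set 'rV[R]_n := [set x | qf A x <= 1].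

Lemma ellip0 A : ellip A 0.
Proof. by rewrite /ellip /= qf0 ler01. Qed.

Lemma qf_inv A x : posdef A -> qf (invmx A) (x *m A) = qf A x.
Proof.
by move=> pA; have [sA _] := pA; rewrite /qf mulmxK ?posdef_unit// trmx_mul sA mulmxA.
Qed.

Lemma conv_sqr_le (t a b : R) : 0 < t < 1 -> 0 <= a -> 0 <= b ->
  (1 - t) * a ^+ 2 + t * b ^+ 2 <= 1 -> (1 - t) * a + t * b <= 1.
Proof.
move=> /andP[t0 t1] a0 b0 h; have h1 : 0 <= 1 - t by lra.
rewrite -(ler_pXn2r (ltn0Sn 1)) ?nnegrE ?addr_ge0 ?mulr_ge0 ?ler01 ?(ltW t0)//.
rewrite expr1n (le_trans _ h)// -subr_ge0.
suff -> : (1 - t) * a ^+ 2 + t * b ^+ 2 - ((1 - t) * a + t * b) ^+ 2 =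
  t * (1 - t) * (a - b) ^+ 2 by rewrite mulr_ge0 ?sqr_ge0// mulr_ge0// ltW.
by ring.
Qed.

(** By [qf_inv], the square root of [qf A x] is the norm of [x *m A] for the form of [invmx A];
    dividing by it gives [u]. *)
Lemma ellip_decomp A x : posdef A -> exists2 u,
  ellip (invmx A) u & x *m A = Num.sqrt (qf A x) *: u.
Proof.
move=> pA; have [sA hA] := pA; have q0 := posdef_ge0 x pA.
have [x0|x0] := eqVneq x 0.
  by exists 0; [exact: ellip0|rewrite x0 mul0mx scaler0].
have s0 : Num.sqrt (qf A x) != 0 by rewrite sqrtr_eq0 -ltNge hA.
exists ((Num.sqrt (qf A x))^-1 *: (x *m A)); last by rewrite scalerA mulfV// scale1r.
by rewrite /ellip/= qfZ qf_inv// exprVn sqr_sqrtr// mulVf// gt_eqF// hA.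
Qed.

(* For z = x Bt^-1 the summands of x = (1 - t) z A + t z B are multiples of points of
   the two ellipsoids, and the sum of the coefficients is at most 1 by convexity of the square. *)
Lemma ellip_conv K A B t :
  (forall x y a b, 0 <= a -> 0 <= b -> a + b <= 1 -> K x -> K y -> K (a *: x + b *: y)) ->
  0 < t < 1 -> posdef A -> posdef B ->
  ellip (invmx A) `<=` K -> ellip (invmx B) `<=` K ->
  ellip (invmx ((1 - t) *: A + t *: B)) `<=` K.
Proof.
move=> cK t01 pA pB AK BK x; set C := (X in invmx X) => hx.
have pC : posdef C by exact: posdef_conv.
pose z := x *m invmx C.
have xz : x = z *m C by rewrite mulmxKV// posdef_unit.
move: hx; rewrite xz /ellip/= qf_inv// qfD !qf_scale => hx.
have [u uA zA] := ellip_decomp z pA; have [v vB zB] := ellip_decomp z pB.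
rewrite mulmxDr -!scalemxAr zA zB !scalerA.
have /andP[t0 t1] := t01.
apply: cK; [| | |exact: AK|exact: BK].
- by rewrite mulr_ge0 ?sqrtr_ge0// subr_ge0 ltW.
- by rewrite mulr_ge0 ?sqrtr_ge0// ltW.
- apply: conv_sqr_le; rewrite ?sqrtr_ge0//.
  by rewrite !sqr_sqrtr// posdef_ge0.
Qed.

Lemma trace_sandwich A B : \tr (B *m A *m B^T) = \sum_i qf A (row i B).
Proof.
apply: eq_bigr => i _; rewrite -qf_delta qf_congr; congr qf.
by rewrite rowE.
Qed.

(** With [w = x *m invmx A], expand the nonnegative squared length of [2 *: x - w]; its mixed term
    is a multiple of [qf A w], which is also the left side of the claim. This bounds the remainder
    in the expansion of the trace below. *)
Lemma qf_inv_le A x : posdef A ->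
  (forall y, qf 1%:M y <= 2 * qf A y) -> qf (invmx A) x <= 2 * qf 1%:M x.
Proof.
move=> pA hA; set w := x *m invmx A.
have [sA _] := pA.
have xw : x = w *m A by rewrite mulmxKV// posdef_unit.
have q : qf (invmx A) x = qf A w by rewrite xw qf_inv.
have dot : (x *m w^T) 0 0 = qf A w by rewrite xw.
have := posdef_ge0 (2 *: x - w) posdef1.
have -> : qf 1%:M (2 *: x - w) = 4 * qf 1%:M x - 4 * qf A w + qf 1%:M w.
  rewrite -dot !qf1 [(x *m _) 0 0]mxE !mulr_sumr -sumrB -big_split/=.
  by apply: eq_bigr => i _; rewrite !mxE; ring.
by have := hA w; rewrite q; lra.
Qed.

(* The first order expansion of tr Bt^-1 at t = 0 is n - t tr (B - 1). *)
Lemma trace_first_order B : posdef B ->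
  (forall t, 0 < t < 1 -> n%:R <= \tr (invmx ((1 - t) *: 1%:M + t *: B))) ->
  \tr B <= n%:R.
Proof.
move=> pB h; pose X := B - 1%:M; have [sB _] := pB.
have sX : X^T = X by rewrite linearB /= sB trmx1.
(* [c] is the trace of [X *m X^T], and [2 * c] will bound the coefficient of [t ^+ 2]. *)
pose c := \sum_i qf 1%:M (row i X).
have c0 : 0 <= c by apply: sumr_ge0 => i _; exact: posdef_ge0 posdef1.
have trX : \tr X = \tr B - n%:R by rewrite linearB /= mxtrace1.
(* For these [t] the matrix [C] is at least one half of the identity, so that [qf_inv_le] applies to
   it. *)
have key t : 0 < t <= 2^-1 -> \tr X <= t * (2 * c).
  move=> /andP[t0 t12]; have t1 : 0 < t < 1 by lra.
  have := h t t1; set C := (X in invmx X) => hC.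
  have pC : posdef C by apply: posdef_conv => //; exact: posdef1.
  have uC := posdef_unit pC.
  have eC : C = 1%:M + t *: X.
    by rewrite /C /X scalerBl scale1r scalerBr addrA addrAC -addrA [- _ + _]addrC.
  have e1 : invmx C = 1%:M - t *: (X *m invmx C).
    by rewrite -[in LHS](mul1mx (invmx C)) -[1%:M in LHS](addrK (t *: X)) -eC mulmxBl
      mulmxV// scalemxAl.
  have e2 : invmx C = 1%:M - t *: (invmx C *m X).
    by rewrite -[in LHS](mulmx1 (invmx C)) -[1%:M in LHS](addrK (t *: X)) -eC mulmxBr
      mulVmx// scalemxAr.
  (* Substituting [e2] into [e1] gives an exact expansion of second order with a symmetric
     remainder. *)
  have e3 : invmx C = 1%:M - t *: X + t ^+ 2 *: (X *m invmx C *m X^T).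
    rewrite {1}e1 {1}e2 sX mulmxBr mulmx1 scalerBr opprB addrA addrAC; congr (_ + _).
    by rewrite -scalemxAr scalerA mulmxA expr2.
  have le2 : \tr (X *m invmx C *m X^T) <= 2 * c.
    rewrite trace_sandwich mulr_sumr; apply: ler_sum => i _; apply: qf_inv_le => // y.
    have := posdef_ge0 y pB; have := posdef_ge0 y posdef1.
    rewrite qfD !qf_scale => y1 yB.
    have : 0 <= t * qf B y by rewrite mulr_ge0// ltW.
    by have : 0 <= (2^-1 - t) * qf 1%:M y; [rewrite mulr_ge0//; lra|lra].
  move: hC; rewrite e3 -scaleNr mxtraceD [\tr (1%:M + _)]mxtraceD !mxtraceZ mxtrace1 mulNr => hC.
  have : t * \tr X <= t * (t * (2 * c)).
    have : t ^+ 2 * \tr (X *m invmx C *m X^T) <= t ^+ 2 * (2 * c).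
      by rewrite ler_wpM2l// sqr_ge0.
    by rewrite mulrA -expr2; lra.
  by rewrite ler_pM2l.
rewrite -subr_le0 -trX leNgt; apply/negP => X0.
have d0 : 0 < 4 * c + 2 * \tr X + 1 by lra.
(* The summand [2 * \tr X] keeps this [t] below one half, and [4 * c] makes [t * (2 * c)] smaller
   than [\tr X], against [key]. *)
have := key (\tr X / (4 * c + 2 * \tr X + 1)).
rewrite divr_gt0//= ler_pdivrMr// mulrAC ler_pdivlMr//.
have := mulr_ge0 (ltW X0) c0; have := mulr_gt0 X0 X0.
set p := \tr X * \tr X; set q := \tr X * c => h1 h2.
have -> : \tr X <= 2^-1 * (4 * c + 2 * \tr X + 1) by lra.
move=> /(_ isT).
have -> : \tr X * (4 * c + 2 * \tr X + 1) = 4 * q + 2 * p + \tr X by rewrite /p /q; ring.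
have -> : \tr X * (2 * c) = 2 * q by rewrite /q; ring.
by lra.
Qed.

Lemma mulmx1_invmx A B : A *m B = 1%:M -> B = invmx A.
Proof.
move=> AB; have [uA _] := mulmx1_unit AB.
by rewrite -[RHS]mulmx1 -AB mulKmx.
Qed.

Lemma invmx_congr T A : T \in unitmx -> A \in unitmx ->
  invmx (T *m A *m T^T) = invmx T^T *m invmx A *m invmx T.
Proof.
move=> uT uA; apply/esym/mulmx1_invmx.
by rewrite -!mulmxA mulKVmx ?unitmx_tr// (mulmxA A) mulmxV// mul1mx mulmxV.
Qed.

Lemma det_congr1 A T : T *m A *m T^T = 1%:M -> \det T ^+ 2 * \det A = 1.
Proof.
by move/(congr1 determinant); rewrite !det_mulmx det_tr det1 => <-; rewrite expr2 mulrAC.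
Qed.

(** This is [posdef_trace_det_eq1] for [T *m A *m T^T], whose determinant is the quotient of
    [\det A] by [\det A0]. *)
Lemma posdef_trace_det_eq A0 A T : T \in unitmx -> T *m A0 *m T^T = 1%:M ->
  posdef A -> \det A0 <= \det A -> \tr (T *m A *m T^T) <= n%:R -> A = A0.
Proof.
move=> uT T1 pA d tr.
have dT := det_congr1 T1.
have dT0 : 0 < \det T ^+ 2 by rewrite lt_neqAle sqr_ge0 andbT eq_sym sqrf_eq0 -unitfE -unitmxE.
have : T *m A *m T^T = 1%:M.
  apply: posdef_trace_det_eq1 => //; first exact: posdef_congr.
  by rewrite !det_mulmx det_tr mulrAC -expr2 -dT ler_pM2l.
have uTt : T^T \in unitmx by rewrite unitmx_tr.
by rewrite -T1 => /(can_inj (mulmxK uTt)) /(can_inj (mulKmx uT)).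
Qed.

(** As a smaller determinant means a larger volume, the conclusion gives at once that [ellip A0] has
    maximal volume and that it is the only such ellipsoid. *)
Lemma min_trace_max_det K A0 T :
  (forall x y a b, 0 <= a -> 0 <= b -> a + b <= 1 -> K x -> K y -> K (a *: x + b *: y)) ->
  posdef A0 -> ellip A0 `<=` K -> T \in unitmx -> T *m A0 *m T^T = 1%:M ->
  (forall A, posdef A -> ellip A `<=` K -> n%:R <= \tr (T *m A *m T^T)) ->
  forall A, posdef A -> ellip A `<=` K -> \det A <= \det A0 -> A = A0.
Proof.
move=> cK pA0 A0K uT T1 hmin A pA AK dA.
have uTt : T^T \in unitmx by rewrite unitmx_tr.
have dT := det_congr1 T1.
have dT0 : 0 < \det T ^+ 2 by rewrite lt_neqAle sqr_ge0 andbT eq_sym sqrf_eq0 -unitfE -unitmxE.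
set A' := T *m A *m T^T.
have pA' : posdef A' by exact: posdef_congr.
have uA' := posdef_unit pA'.
suff : invmx A' = 1%:M.
  move=> /(congr1 invmx); rewrite invmxK invmx1 /A' -T1.
  by move=> /(can_inj (mulmxK uTt)) /(can_inj (mulKmx uT)).
apply: posdef_trace_det_eq1; first exact: posdef_inv.
  apply: trace_first_order; first exact: posdef_inv.
  move=> t t01; set C := (_ + _).
  have pI0 := posdef_inv pA0; have pI := posdef_inv pA.
  (* The segment from the identity to [invmx A'] is, up to the change of basis, the segment from
     [invmx A0] to [invmx A], to which [ellip_conv] applies. *)
  have -> : invmx C = T *m invmx ((1 - t) *: invmx A0 + t *: invmx A) *m T^T.
    have eC : C = invmx T^T *m ((1 - t) *: invmx A0 + t *: invmx A) *m invmx T.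
      have uA0 := posdef_unit pA0; have uA := posdef_unit pA.
      rewrite /C -[X in _ *: X + _]invmx1 -T1 !invmx_congr//.
      by rewrite mulmxDr mulmxDl -!scalemxAr -!scalemxAl.
    apply/esym/mulmx1_invmx; rewrite eC -!mulmxA (mulKmx uT) (mulmxA _ _ T^T) mulmxV; last first.
      exact/posdef_unit/posdef_conv.
    by rewrite mul1mx mulVmx.
  apply: hmin; [exact/posdef_inv/posdef_conv|].
  by apply: ellip_conv cK t01 pI0 pI _ _; rewrite invmxK.
rewrite det_inv invf_ge1 ?posdef_det_gt0// -dT !det_mulmx det_tr mulrAC -expr2.
by rewrite ler_pM2l.
Qed.
End Optimization.

(** * Volume *)

Section OuterMeasure.
Context {R : realType} {n : nat}.
Local Notation V := 'rV[R]_n.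
Implicit Types (a b : V) (A B : set V).

Definition boxvol a b : R := \prod_i (b 0 i - a 0 i).

Lemma boxvol_ge0 a b : (forall i, a 0 i <= b 0 i) -> 0 <= boxvol a b.
Proof. by move=> ab; apply: prodr_ge0 => i _; rewrite subr_ge0. Qed.

Lemma volume_ge0 A : (0 <= volume A)%E.
Proof.
apply: le_ereal_inf_tmp => _ [a [b [ab _ ->]]].
by apply: nneseries_ge0 => k _ _; rewrite lee_fin boxvol_ge0.
Qed.

Lemma volume_le A B : A `<=` B -> (volume A <= volume B)%E.
Proof.
move=> AB; apply/ereal_inf_le_tmp => _ [a [b [ab hB ->]]].
by exists a, b; split => //; exact: subset_trans hB.
Qed.

(** Countable subadditivity: nearly optimal coverings of the [A k], with errors summing to [e], are
    merged along a bijection between [nat] and [nat * nat]. *)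
Lemma volume_bigcup (A : nat -> set V) :
  (volume (\bigcup_k A k) <= \sum_(0 <= k <oo) volume (A k))%E.
Proof.
have [[i ioo]|/forallNP Aoo] := pselect (exists i, volume (A i) = +oo%E).
  rewrite (eseries_pinfty _ _ ioo) ?leey// => m _.
  by rewrite -ltNye (lt_le_trans _ (volume_ge0 _)).
apply/lee_addgt0Pr => e e0.
apply: le_trans (epsilon_trick xpredT (fun k => volume_ge0 (A k)) (ltW e0)).
pose P k (c : nat -> V * V) := [/\ forall j i, (c j).1 0 i <= (c j).2 0 i,
  A k `<=` \bigcup_j box (c j).1 (c j).2 &
  (\sum_(0 <= j <oo) (boxvol (c j).1 (c j).2)%:E <= volume (A k) + (e / (2 ^ k.+1)%:R)%:E)%E].
have [G PG] : {G : nat -> nat -> V * V & forall k, P k (G k)}.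
  apply: choice => k.
  have fA : volume (A k) \is a fin_num.
    by rewrite ge0_fin_numE ?volume_ge0// ltey; apply/eqP/Aoo.
  have ek : 0 < e / (2 ^ k.+1)%:R by rewrite divr_gt0// ltr0n expn_gt0.
  have [_ [a [b [ab Ak ->]]] lt] := lb_ereal_inf_adherent ek fA.
  by exists (fun j => (a j, b j)); split => //; exact/ltW.
pose v (p : nat * nat) := (boxvol (G p.1 p.2).1 (G p.1 p.2).2)%:E.
have v0 p : (0 <= v p)%E by rewrite lee_fin boxvol_ge0//; case: (PG p.1).
have /card_esym/ppcard_eqP[f] := card_nat2.
apply: (@le_trans _ _ (\sum_(0 <= k <oo) v (f k))%E).
  apply: ereal_inf_lbound.
  exists (fun k => (G (f k).1 (f k).2).1), (fun k => (G (f k).1 (f k).2).2); split => //.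
    by move=> k i; have [+ _ _] := PG (f k).1; apply.
  move=> x [k _ Akx]; have [_ /(_ x Akx) [j _ xj] _] := PG k.
  by exists (f^-1%FUN (k, j)) => //; rewrite invK ?inE.
rewrite nneseries_esumT; last by move=> k; exact: v0.
rewrite -(reindex_esum setT setT f v); last exact: bij.
have -> : [set: nat * nat] = [set: nat] `*`` (fun=> [set: nat]).
  by apply/seteqP; split => // -[].
rewrite -(@esum_esum R nat nat setT (fun=> setT) (fun i j => v (i, j)))//.
rewrite -nneseries_esumT; last by move=> k; apply: esum_ge0.
apply: lee_nneseries => [k _ _|k _]; first by apply: esum_ge0.
by rewrite -nneseries_esumT//; case: (PG k).
Qed.

Hypothesis n0 : (0 < n)%N.

(** In dimension 0 the empty product would be 1. Degenerate boxes serve to pad finite coverings to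
    sequences. *)
Lemma boxvolxx a : boxvol a a = 0.
Proof. by rewrite /boxvol (bigD1 (Ordinal n0))//= subrr mul0r. Qed.

Lemma volume_boxes_le A (N : nat) (a b : nat -> V) :
  (forall k i, (k < N)%N -> a k 0 i <= b k 0 i) ->
  (forall x, A x -> exists2 k, (k < N)%N & box (a k) (b k) x) ->
  (volume A <= (\sum_(k < N) boxvol (a k) (b k))%:E)%E.
Proof.
move=> ab cov; apply: ereal_inf_lbound.
exists a, (fun k => if (k < N)%N then b k else a k); split.
- by move=> k i; case: ifP => // kN; exact: ab.
- by move=> x /cov[k kN xk]; exists k => //; rewrite kN.
rewrite (@nneseries_split _ _ 0 N); last first.
  move=> k _; rewrite lee_fin; apply: boxvol_ge0 => i.
  by case: ifP => // kN; exact: ab.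
rewrite eseries0 ?adde0 => [|k kN _]; last first.
  by rewrite ltnNge kN/= -/(boxvol _ _) boxvolxx.
rewrite add0n big_mkord sumEFin; congr (_%:E); apply: eq_bigr => k _.
by rewrite ltn_ord.
Qed.

Lemma volume_box_le a b : (forall i, a 0 i <= b 0 i) ->
  (volume (box a b) <= (boxvol a b)%:E)%E.
Proof.
move=> ab; have -> : boxvol a b = \sum_(k < 1) boxvol a b by rewrite big_ord1.
by apply: (@volume_boxes_le _ 1 (fun=> a) (fun=> b)) => // x xab; exists 0%N.
Qed.

(** Apply the bound to each box of a covering of [A] and use subadditivity. *)
Lemma volume_image_le (T : V -> V) (c : R) : 0 < c ->
  (forall a b, (forall i, a 0 i <= b 0 i) ->
     (volume (T @` box a b) <= (c * boxvol a b)%:E)%E) ->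
  forall A, (volume (T @` A) <= c%:E * volume A)%E.
Proof.
move=> c0 hT A; rewrite -lee_pdivrMl//; apply: le_ereal_inf_tmp => _ [a [b [ab hA ->]]].
rewrite lee_pdivrMl// -nneseriesZl => [|k _]; last by rewrite lee_fin boxvol_ge0.
apply: (@le_trans _ _ (volume (T @` \bigcup_k box (a k) (b k)))).
  by apply: volume_le => _ [x /hA xA <-]; exists x.
rewrite image_bigcup; apply: le_trans (volume_bigcup _) _.
apply: lee_nneseries => [k _ _|k _]; first exact: volume_ge0.
by rewrite -EFinM; exact: hT.
Qed.

End OuterMeasure.

(** Induction on the dimension, after the pattern of Fubini: with the last coordinate fixed at [t],
    the boxes whose last side contains [t] keep their weights and the others get weight 0; the
    inequality so obtained is integrated over [t]. The weights are there to make this induction go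
    through. *)
Lemma weighted_box_cover (R : realType) m (a b : nat -> R) (A B : nat -> nat -> R)
    (c : nat -> R) :
  (forall i, (i < m)%N -> a i <= b i) ->
  (forall k i, A k i <= B k i) -> (forall k, 0 <= c k) ->
  (forall x : nat -> R, (forall i, (i < m)%N -> a i <= x i <= b i) ->
     (1 <= \sum_(0 <= k <oo) (c k * \prod_(i < m) (A k i <= x i <= B k i)%R%:R)%:E)%E) ->
  ((\prod_(i < m) (b i - a i))%:E <=
    \sum_(0 <= k <oo) (c k * \prod_(i < m) (B k i - A k i))%:E)%E.
Proof.
elim: m c => [|m IH] c ab AB c0 cov.
  rewrite big_ord0; have := cov a (fun i => ltac:(by [])).
  by under eq_eseriesr do rewrite big_ord0; under [in X in _ -> X]eq_eseriesr do rewrite big_ord0.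
have ind0 (q : bool) : 0 <= q%:R :> R by case: q.
pose p k := \prod_(i < m) (B k i - A k i).
have p0 k : 0 <= p k by apply: prodr_ge0 => i _; rewrite subr_ge0.
pose D : set R := `[a m, b m]%classic.
have mD : measurable D by exact: measurable_itv.
pose F k (t : R) : \bar R := (c k * p k * \1_(`[A k m, B k m]%classic) t)%:E.
have step t : D t -> ((\prod_(i < m) (b i - a i))%:E <=
    \sum_(0 <= k <oo) F k t)%E.
  rewrite /F /D /= in_itv /= => tD.
  have cE k : c k * p k * \1_(`[A k m, B k m]%classic) t = c k * (A k m <= t <= B k m)%R%:R * p k.
    by rewrite indicE mem_setE in_itv/= mulrAC.
  under eq_eseriesr do rewrite cE.
  apply: IH => //; first by move=> i im; apply: ab; exact: ltnW.
    by move=> k; rewrite mulr_ge0.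
  (* [y] is the point of the full box with last coordinate [t] and the other coordinates from
     [x]. *)
  move=> x hx; pose y i := if i == m then t else x i.
  have hy i : (i < m.+1)%N -> a i <= y i <= b i.
    rewrite ltnS leq_eqVlt /y; case: eqP => [->//|_ /=]; exact: hx.
  apply: le_trans (cov y hy) _; rewrite le_eqVlt; apply/orP; left; apply/eqP.
  apply: eq_eseriesr => k _; have ym : y m = t by rewrite /y eqxx.
  rewrite big_ord_recr/= ym; under eq_bigr => i _ do rewrite /y (ltn_eqF (ltn_ord i)).
  by rewrite mulrA mulrAC.
have mf k : measurable_fun D (F k).
  apply/measurable_EFinP; apply: measurable_funM => //.
(* Integrating [step] over [D] produces the missing factor [b m - a m] on the left. *)
have := @ge0_le_integral _ _ R lebesgue_measure D mD
  (cst (\prod_(i < m) (b i - a i))%:E)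
  (fun t => \sum_(0 <= k <oo) F k t)%E.
have pos k t : (0 <= F k t)%E.
  by rewrite lee_fin !mulr_ge0// indicE.
move=> /(_ _ _ _ step) le1.
have {le1} : ((\prod_(i < m) (b i - a i))%:E * lebesgue_measure D <=
   \sum_(0 <= k <oo) (c k * p k)%:E * lebesgue_measure (`[A k m, B k m]%classic `&` D))%E.
  rewrite -integral_cst//; apply: le_trans (le1 _ _ _) _.
  - by move=> t _ /=; rewrite lee_fin prodr_ge0// => i _; rewrite subr_ge0 ab// ltnS ltnW.
  - by [].
  - by apply: ge0_emeasurable_sum => // k _; exact: mf.
  rewrite integral_nneseries//; apply: lee_nneseries => [k _ _|k _].
    by apply: integral_ge0 => t _.
  under eq_integral do rewrite /F EFinM.
  rewrite ge0_integralZl_EFin//; last by rewrite mulr_ge0.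
    by rewrite integral_indic.
  by apply/measurable_EFinP; exact: measurable_indic.
have am : a m <= b m by apply: ab.
have lD : lebesgue_measure D = (b m - a m)%:E.
  rewrite lebesgue_measure_itv/= lte_fin; case: ltP => [_|ba]; first by rewrite EFinB.
  have -> : a m = b m by apply/eqP; rewrite eq_le am ba.
  by rewrite subrr.
rewrite lD -EFinM big_ord_recr/= => h; apply: le_trans h _.
apply: lee_nneseries => [k _ _|k _]; first by rewrite mule_ge0// lee_fin mulr_ge0.
rewrite big_ord_recr/= mulrA [leRHS]EFinM; apply: lee_wpmul2l; first by rewrite lee_fin mulr_ge0.
apply: (@le_trans _ _ (lebesgue_measure `[A k m, B k m]%classic)).
  by apply: le_measure; rewrite ?inE//; exact: measurableI.
rewrite lebesgue_measure_itv/= lte_fin; case: ltP => [_|_]; first by rewrite -EFinB.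
by rewrite lee_fin subr_ge0.
Qed.

Lemma slab (R : realDomainType) (N : nat) (a x h : R) : (0 < N)%N ->
  a <= x <= a + N%:R * h ->
  exists2 m, (m < N)%N & a + m%:R * h <= x <= a + m.+1%:R * h.
Proof.
elim: N => // N IH _ /andP[ax xN].
have [N0|N0] := posnP N.
  by exists 0%N => //; rewrite mul0r addr0 ax -N0.
have [xN'|xN'] := leP x (a + N%:R * h); last by exists N => //; rewrite (ltW xN').
have [|m mN hm] := IH N0; first by rewrite ax.
by exists m => //; exact: ltnW.
Qed.

(** * Effect of diagonal maps and shears on volume *)

Section LinearImages.
Context {R : realType} {n : nat}.
Local Notation V := 'rV[R]_n.
Implicit Types (a b : V) (A B : set V) (S T : 'M[R]_n).
Hypothesis n0 : (0 < n)%N.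

Definition volume_preserving S :=
  forall A, volume [set x *m S | x in A] = volume A.

Lemma volume_preserving1 : volume_preserving 1%:M.
Proof.
move=> A; congr volume; apply/seteqP; split => [_ [x Ax <-]|x Ax].
  by rewrite mulmx1.
by exists x; rewrite ?mulmx1.
Qed.

Lemma image_mulmx S T A :
  [set x *m (S *m T) | x in A] = [set x *m T | x in [set x *m S | x in A]].
Proof. by rewrite image_comp; congr (_ @` A); apply/funext => x /=; rewrite mulmxA. Qed.

Lemma volume_preservingM S T : volume_preserving S -> volume_preserving T ->
  volume_preserving (S *m T).
Proof. by move=> hS hT A; rewrite image_mulmx hT hS. Qed.

Lemma mul_diagE (d x : V) i : (x *m diag_mx d) 0 i = x 0 i * d 0 i.
Proof. by rewrite mul_mx_diag mxE. Qed.

Lemma volume_diag_le (d : V) A : (forall i, 0 < d 0 i) ->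
  (volume [set (x : V) *m diag_mx d | x in A] <= (\prod_i d 0 i)%:E * volume A)%E.
Proof.
move=> d0; apply: (@volume_image_le R n (fun x => x *m diag_mx d)).
  by apply: prodr_gt0 => i _.
move=> a b ab.
apply: (@le_trans _ _ (volume (box (a *m diag_mx d) (b *m diag_mx d)))).
  apply: volume_le => _ [x xab <-] i; rewrite !mul_diagE.
  by rewrite !ler_pM2r.
apply: le_trans (volume_box_le n0 _) _.
  by move=> i; rewrite !mul_diagE ler_pM2r.
rewrite lee_fin /boxvol -big_split/= le_eqVlt; apply/orP; left; apply/eqP.
by apply: eq_bigr => i _; rewrite !mul_diagE; ring.
Qed.

(** The reverse inequality is [volume_diag_le] for the inverse diagonal map. *)
Lemma volume_diag (d : V) A : (forall i, 0 < d 0 i) ->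
  (volume [set (x : V) *m diag_mx d | x in A] = (\prod_i d 0 i)%:E * volume A)%E.
Proof.
move=> d0; apply/eqP; rewrite eq_le volume_diag_le//=.
have p0 : 0 < \prod_i d 0 i by apply: prodr_gt0 => i _.
rewrite -lee_pdivlMl//.
pose e : V := \row_i (d 0 i)^-1.
have e0 i : 0 < e 0 i by rewrite mxE invr_gt0.
have de : diag_mx d *m diag_mx e = 1%:M.
  rewrite mul_mx_diag; apply/matrixP => i j; rewrite !mxE.
  by have [->|] := eqVneq i j; rewrite ?mul0r// mulr1n mulfV// gt_eqF.
have {1}-> : A = [set (x : V) *m diag_mx e | x in [set (x : V) *m diag_mx d | x in A]].
  rewrite -image_mulmx de; apply/seteqP; split => [x Ax|_ [x Ax <-]].
    by exists x; rewrite ?mulmx1.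
  by rewrite mulmx1.
apply: le_trans (volume_diag_le _ e0) _.
rewrite le_eqVlt; apply/orP; left; apply/eqP; congr (_%:E * _)%E.
by rewrite -prodfV; apply: eq_bigr => i _; rewrite mxE.
Qed.

Definition elem_shear (j k : 'I_n) (s : R) : 'M[R]_n := shear k (s *: delta_mx j 0).

Lemma mul_shear_delta (j k : 'I_n) (s : R) (x : V) i :
  (x *m elem_shear j k s) 0 i = x 0 i + s * x 0 j * (i == k)%:R.
Proof.
by rewrite /elem_shear mul_shearE -scalemxAr mxE -colE mxE.
Qed.

(* Cut the box into N slabs orthogonal to e_j: each sheared slab lies in a box, and the
   excess of the total volume of these boxes is O(1/N). *)
Lemma volume_shear_delta_le (j k : 'I_n) (s : R) A : j != k ->
  (volume [set (x : V) *m elem_shear j k s | x in A] <= volume A)%E.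
Proof.
move=> jk; rewrite -[leRHS]mul1e.
apply: (@volume_image_le R n (fun x => x *m elem_shear j k s)) => // a b ab.
rewrite mul1r; apply/lee_addgt0Pr => e e0.
pose P := \prod_(i | (i != j) && (i != k)) (b 0 i - a 0 i).
have P0 : 0 <= P by apply: prodr_ge0 => i _; rewrite subr_ge0.
pose wj := b 0 j - a 0 j; pose wk := b 0 k - a 0 k.
have wj0 : 0 <= wj by rewrite subr_ge0.
have wk0 : 0 <= wk by rewrite subr_ge0.
(* Each of the [N] slabs, of width [h = wj / N], contributes the excess [2 * |s| * h ^+ 2 * P]; the
   total is [c / N]. *)
pose c := 2 * `|s| * wj ^+ 2 * P.
have c0 : 0 <= c by rewrite !mulr_ge0// sqr_ge0.
pose N := (Num.bound (c / e)).+1.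
have N0 : 0 < N%:R :> R by rewrite ltr0n.
have cN : c / N%:R <= e.
  rewrite ler_pdivrMr// mulrC -ler_pdivrMr// ltW//.
  apply: lt_le_trans (archi_boundP _) _; first by rewrite divr_ge0// ltW.
  by rewrite ler_nat /N.
pose h := wj / N%:R.
have h0 : 0 <= h by rewrite divr_ge0// ltW.
have Nh : N%:R * h = wj by rewrite /h mulrC divfK// gt_eqF.
pose lo (m : nat) := a 0 j + m%:R * h.
(* In slab [m] the displacement [s * x 0 j] differs from [s * lo m] by at most [|s| * h], so side
   [k] is widened by this much at both ends. *)
pose a' m : V := \row_i if i == j then lo m else
  if i == k then a 0 k + s * lo m - `|s| * h else a 0 i.
pose b' m : V := \row_i if i == j then lo m.+1 else
  if i == k then b 0 k + s * lo m + `|s| * h else b 0 i.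
have loS m : lo m.+1 = lo m + h by rewrite /lo -natr1; ring.
have sh0 : 0 <= `|s| * h by rewrite mulr_ge0.
apply: (@le_trans _ _ (\sum_(m < N) boxvol (a' m) (b' m))%:E).
  apply: volume_boxes_le => //.
    move=> m i _; rewrite !mxE; case: eqP => [_|_]; first by rewrite loS lerDl.
    by case: eqP => // _; have := ab k; lra.
  move=> _ [x xab <-]; have xj := xab j.
  have [||m mN hm] := @slab _ N (a 0 j) (x 0 j) h => //.
    by rewrite Nh /wj addrC subrK.
  exists m => // i; rewrite !mxE; move: (mul_shear_delta j k s x i); rewrite mxE => ->.
  case: eqP => [->|_]; first by rewrite (negbTE jk) mulr0 addr0.
  case: eqP => [->|_]; last by rewrite mulr0 addr0; exact: xab.
  rewrite mulr1; have := xab k.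
  have : `|s * x 0 j - s * lo m| <= `|s| * h.
    rewrite -mulrBr normrM ler_wpM2l// ger0_norm; move: hm; rewrite -/(lo m) -/(lo m.+1) loS; lra.
  by rewrite ler_norml; lra.
have vm m : boxvol (a' m) (b' m) = h * (wk + 2 * `|s| * h) * P.
  rewrite /boxvol (bigD1 j)//= (bigD1 k) ?(eq_sym k)//= !mxE !eqxx eq_sym (negbTE jk) loS mulrA.
  congr (_ * _); first by rewrite /wk; ring.
  by apply: eq_bigr => i /andP[ij ik]; rewrite !mxE (negbTE ij) (negbTE ik).
under eq_bigr do rewrite vm.
rewrite sumr_const card_ord -EFinD lee_fin.
have -> : boxvol a b = wj * wk * P.
  by rewrite /boxvol (bigD1 j)//= (bigD1 k) ?(eq_sym k)//= mulrA.
have -> : (h * (wk + 2 * `|s| * h) * P) *+ N = wj * wk * P + c / N%:R.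
  by rewrite -mulr_natl /c /h; field; exact: lt0r_neq0.
by rewrite lerD2l.
Qed.

(** A shear along one coordinate is undone by the one with [- s], which turns the inequality into an
    equality; by [shearD] a general shear is a product of such shears. *)
Lemma volume_preserving_shear (k : 'I_n) (v : 'cV[R]_n) : v k 0 = 0 ->
  volume_preserving (shear k v).
Proof.
have one (j : 'I_n) (s : R) : j != k -> volume_preserving (elem_shear j k s).
  move=> jk A; apply/eqP; rewrite eq_le volume_shear_delta_le//=.
  have vk (t : R) : (t *: delta_mx j 0 : 'cV[R]_n) k 0 = 0.
    by rewrite !mxE eq_sym (negbTE jk) mulr0.
  have {1}-> : A = [set (x : V) *m elem_shear j k (- s) | x in
      [set (x : V) *m elem_shear j k s | x in A]].
    rewrite -image_mulmx /elem_shear shearD// -scalerDl addNr scale0r shear0.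
    apply/seteqP; split => [x Ax|_ [x Ax <-]]; last by rewrite mulmx1.
    by exists x; rewrite ?mulmx1.
  exact: volume_shear_delta_le.
move=> vk.
have -> : v = \sum_(j | j != k) v j 0 *: delta_mx j 0.
  rewrite [LHS](matrix_sum_delta) (bigD1 k)//= big_ord1 vk scale0r add0r.
  by apply: eq_bigr => j _; rewrite big_ord1.
suff [] : (\sum_(j | j != k) v j 0 *: delta_mx j 0 : 'cV[R]_n) k 0 = 0 /\
  volume_preserving (shear k (\sum_(j | j != k) v j 0 *: delta_mx j 0)) by [].
apply: (big_ind (fun w : 'cV[R]_n => w k 0 = 0 /\ volume_preserving (shear k w))).
- by split; [rewrite mxE|rewrite shear0; exact: volume_preserving1].
- move=> x y [xk px] [yk py]; split; first by rewrite mxE xk yk addr0.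
  by rewrite -shearD//; exact: volume_preservingM.
- by move=> j jk; split; [rewrite !mxE eq_sym (negbTE jk) mulr0|exact: one].
Qed.

(** This is [weighted_box_cover] with all weights equal to 1. *)
Lemma boxvol_le_volume a b : (forall i, a 0 i <= b 0 i) ->
  ((boxvol a b)%:E <= volume (box a b))%E.
Proof.
move=> ab; apply: le_ereal_inf_tmp => _ [c [d [cd hcov ->]]].
(* Indices from [n] on read coordinate 0, so that the inequalities between the bounds hold at every
   index. *)
pose e (f : V) (i : nat) := f 0 (odflt (Ordinal n0) (insub i)).
have eE f (i : 'I_n) : e f i = f 0 i by rewrite /e valK.
have bv f g : boxvol f g = \prod_(i < n) (e g i - e f i).
  by apply: eq_bigr => i _; rewrite !eE.
rewrite bv.
have := @weighted_box_cover R n (e a) (e b) (fun k => e (c k)) (fun k => e (d k)) (fun=> 1).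
move=> h; apply: le_trans (h _ _ _ _) _.
- by move=> i _; exact: ab.
- by move=> k i; exact: cd.
- by [].
- move=> x hx; pose y : V := \row_i x i.
  have : box a b y by move=> i; rewrite mxE -!eE; exact: hx.
  move=> /hcov[k _ hk].
  (* The box [k] that contains [y] alone contributes 1, and all terms are nonnegative. *)
  rewrite (@nneseries_split _ _ 0 k.+1); last first.
    by move=> j _; rewrite lee_fin mul1r prodr_ge0// => i _; case: (_ <= _ <= _).
  rewrite add0n big_nat_recr//= -addeA.
  have pos (j : nat) : (0 <= (1 * \prod_(i < n) (e (c j) i <= x i <= e (d j) i)%R%:R : R)%:E)%E.
    by rewrite lee_fin mul1r prodr_ge0// => i _; case: (_ <= _ <= _).
  have <- : (1%:E = (1 * \prod_(i < n) (e (c k) i <= x i <= e (d k) i)%R%:R : R)%:E)%E.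
    congr EFin; rewrite mul1r big1// => i _.
    by have := hk i; rewrite !eE mxE => ->.
  rewrite addeCA leeDl// adde_ge0//; first exact: sume_ge0.
  exact: nneseries_ge0.
- by apply: lee_nneseries => [k _ _|k _]; rewrite mul1r -bv// lee_fin boxvol_ge0.
Qed.

End LinearImages.

(** * Volume of an ellipsoid through its determinant *)

Section EllipsoidVolume.
Context {R : realType} {n : nat}.
Local Notation V := 'rV[R]_n.
Implicit Types (A B S T : 'M[R]_n).
Hypothesis n0 : (0 < n)%N.

Lemma ellip_image A S : S \in unitmx ->
  ellip A = [set x *m S | x in ellip (S *m A *m S^T)].
Proof.
move=> uS; apply/seteqP; split => [x Ax|_ [x + <-]]; last by rewrite /ellip/= qf_congr.
by exists (x *m invmx S); rewrite /ellip/= ?qf_congr mulmxKV.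
Qed.

(** Elimination by volume-preserving maps reduces to a diagonal matrix, whose ellipsoid is a
    diagonal image of the unit ball. The factor [p] is the inverse square root of [\det A]. *)
Lemma volume_ellip A : posdef A -> exists p : R, [/\ 0 < p, p ^+ 2 * \det A = 1 &
  volume (ellip A) = (p%:E * volume (ellip (1%:M : 'M[R]_n)))%E].
Proof.
move=> pA.
have [S [d [vS dS e _ _]]] := @posdef_shear_diag R n volume_preserving A
  volume_preserving1 volume_preservingM (volume_preserving_shear n0) pA.
have uS : S \in unitmx by rewrite unitmxE dS unitr1.
have pD : posdef (diag_mx d) by rewrite -e; apply: posdef_congr.
have d0 i : 0 < d 0 i by have := posdef_diag_gt0 i pD; rewrite mxE eqxx.
pose r : V := \row_i (Num.sqrt (d 0 i))^-1.
have r0 i : 0 < r 0 i by rewrite mxE invr_gt0 sqrtr_gt0.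
have rd i : r 0 i ^+ 2 * d 0 i = 1.
  by rewrite mxE exprVn sqr_sqrtr ?ltW// mulVf// gt_eqF.
exists (\prod_i r 0 i); split.
- by apply: prodr_gt0.
- have -> : \det A = \prod_i d 0 i.
    by rewrite -det_diag -e !det_mulmx det_tr dS mul1r mulr1.
  by rewrite -prodrXl -big_split/= big1.
have ur : diag_mx r \in unitmx.
  by rewrite unitmxE det_diag unitfE; apply/prodf_neq0 => i _; rewrite gt_eqF.
rewrite (ellip_image A uS) vS e (ellip_image (diag_mx d) ur) -volume_diag//.
congr (volume [set _ | _ in ellip _]).
rewrite tr_diag_mx mul_mx_diag mul_diag_mx; apply/matrixP => i j; rewrite !mxE.
have [->|ij] := eqVneq i j; last by rewrite mulr0 mul0r.
by rewrite mulr1n mulrAC -expr2; have := rd j; rewrite mxE.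
Qed.

Lemma volume_ball_gt0 : (0 < volume (ellip (1%:M : 'M[R]_n)))%E.
Proof.
have nR : 0 < n%:R :> R by rewrite ltr0n.
pose a : V := \row_i (- n%:R^-1); pose b : V := \row_i n%:R^-1.
have ab i : a 0 i < b 0 i by rewrite !mxE gtrN// invr_gt0.
apply: (@lt_le_trans _ _ (boxvol a b)%:E).
  by rewrite lte_fin; apply: prodr_gt0 => i _; rewrite subr_gt0.
apply: le_trans (boxvol_le_volume n0 _) _; first by move=> i; exact/ltW.
apply: volume_le => x xab; rewrite /ellip/= qf1.
apply: (@le_trans _ _ (\sum_(i < n) n%:R^-1)); last first.
  by rewrite sumr_const card_ord -[_ *+ n]mulr_natl mulfV// gt_eqF.
apply: ler_sum => i _; have := xab i; rewrite !mxE -ler_norml => xi.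
rewrite -real_normK ?num_real// expr2 -[leRHS]mulr1 ler_pM//.
by rewrite (le_trans xi)// invf_le1// ler1n.
Qed.

Lemma volume_ball_lty : (volume (ellip (1%:M : 'M[R]_n)) < +oo)%E.
Proof.
pose a : V := \row_i (- 1); pose b : V := \row_i 1.
have ab i : a 0 i <= b 0 i by rewrite !mxE; lra.
apply: le_lt_trans (ltry (boxvol a b)).
apply: le_trans (volume_box_le n0 ab); apply: volume_le => x.
rewrite /ellip/= qf1 => hx i; rewrite !mxE -ler_norml.
rewrite -(ler_pXn2r (ltn0Sn 1)) ?nnegrE// real_normK ?num_real// expr1n.
by apply: le_trans hx; rewrite (bigD1 i)//= lerDl sumr_ge0// => j _; exact: sqr_ge0.
Qed.

(** The volume of the unit ball is positive and finite, so it cancels whatever its value. *)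
Lemma volume_ellip_le A B : posdef A -> posdef B ->
  (volume (ellip A) <= volume (ellip B))%E = (\det B <= \det A).
Proof.
move=> pA pB; have [p [p0 pA1 ->]] := volume_ellip pA.
have [q [q0 qB1 ->]] := volume_ellip pB.
move: volume_ball_gt0 volume_ball_lty.
case: (volume (ellip 1%:M)) => // c; rewrite !lte_fin => c0 _.
rewrite -!EFinM lee_fin ler_pM2r//.
have dA := posdef_det_gt0 pA; have dB := posdef_det_gt0 pB.
rewrite -(ler_pXn2r (ltn0Sn 1)) ?nnegrE ?(ltW p0) ?(ltW q0)//.
have -> : p ^+ 2 = (\det A)^-1 by rewrite -[LHS](mulfK (lt0r_neq0 dA)) pA1 mul1r.
have -> : q ^+ 2 = (\det B)^-1 by rewrite -[LHS](mulfK (lt0r_neq0 dB)) qB1 mul1r.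
by rewrite lef_pV2.
Qed.

End EllipsoidVolume.

(** * Scalar products and positive definite matrices *)

Section Gram.
Context {R : realType} {n : nat}.
Local Notation V := 'rV[R]_n.

Definition gram (ip : {dot V for idfun}) : 'M[R]_n :=
  \matrix_(i, j) ip (delta_mx 0 i) (delta_mx 0 j).

Lemma gramE (ip : {dot V for idfun}) x y : ip x y = (x *m gram ip *m y^T) 0 0.
Proof.
rewrite mxE {1}(row_sum_delta y) linear_sumr; apply: eq_bigr => j _.
rewrite linearZr_LR /= mulrC [y^T _ _]mxE; congr (_ * _).
rewrite {1}(row_sum_delta x) linear_sumlz mxE; apply: eq_bigr => i _.
by rewrite linearZl_LR mxE.
Qed.

Lemma posdef_gram (ip : {dot V for idfun}) : posdef (gram ip).
Proof.
split; last by move=> x x0; rewrite /qf -gramE neq0_dnorm_gt0.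
by apply/matrixP => i j; rewrite !mxE hermitian_subproof expr0 mul1r.
Qed.

Lemma unit_ball_gram (ip : {dot V for idfun}) : unit_ball_of ip = ellip (gram ip).
Proof. by apply/seteqP; split => x; rewrite /unit_ball_of /ellip /= /qf gramE. Qed.

End Gram.

Section DotOfMatrix.
Context {R : realType} {n : nat} (A : 'M[R]_n) (pA : posdef A).
Local Notation V := 'rV[R]_n.

(** The converse of [gram]: the instances below make it a scalar product, so that every [ellip A]
    with [A] positive definite is an ellipsoid. *)
Definition dot_of_matrix (x y : V) : R := (x *m A *m y^T) 0 0.

Let dot_zmodl y : zmod_morphism (dot_of_matrix ^~ y).
Proof. by move=> u v; rewrite /dot_of_matrix !mulmxBl !mxE. Qed.

Let dot_zmodr x : zmod_morphism (dot_of_matrix x).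
Proof. by move=> u v; rewrite /dot_of_matrix linearB mulmxBr !mxE. Qed.

Let dot_scalel y : scalable_for *%R (dot_of_matrix ^~ y).
Proof. by move=> a u; rewrite /dot_of_matrix -!scalemxAl mxE. Qed.

Let dot_scaler x : scalable_for (idfun \; *%R) (dot_of_matrix x).
Proof. by move=> a u; rewrite /dot_of_matrix linearZ /= -scalemxAr mxE. Qed.

Let dot_herm x y : dot_of_matrix x y = (-1) ^+ false * idfun (dot_of_matrix y x).
Proof.
have [sA _] := pA; rewrite expr0 mul1r /dot_of_matrix /=.
by rewrite -[in LHS](trmxK (x *m A *m y^T)) [LHS]mxE !trmx_mul trmxK sA mulmxA.
Qed.

Let dot_pos x : x != 0 -> 0 < dot_of_matrix x x.
Proof. by have [_] := pA; apply. Qed.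

HB.instance Definition _ := isBilinear.Build R V V R *%R (idfun \; *%R) dot_of_matrix
  dot_zmodl dot_zmodr dot_scalel dot_scaler.
HB.instance Definition _ := isHermitianSesquilinear.Build R V false idfun dot_of_matrix dot_herm.
HB.instance Definition _ := isDotProduct.Build R V dot_of_matrix dot_pos.

Lemma ellipsoid_ellip : ellipsoid (ellip A).
Proof. by exists dot_of_matrix. Qed.

End DotOfMatrix.

(** * Topology and measurability of ellipsoids *)

Section Topology.
Context {R : realType} {n : nat}.
Local Notation V := 'rV[R]_n.
Implicit Types (A B S T : 'M[R]_n).

Lemma continuous_big_sum (T : topologicalType) (I : Type) (s : seq I) (f : I -> T -> R) :
  (forall i, continuous (f i)) -> continuous (fun x => \sum_(i <- s) f i x).
Proof.
move=> cf; elim: s => [|i s IH] x.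
  by rewrite [X in continuous_at _ X](_ : _ = cst 0);
    [exact: cst_continuous|apply/funext => y; rewrite big_nil].
rewrite [X in continuous_at _ X](_ : _ = (f i \+ fun y => \sum_(i <- s) f i y)).
  by apply: continuousD; [exact: cf|exact: IH].
by apply/funext => y; rewrite big_cons.
Qed.

Lemma continuous_mulmx_coord (M : 'M[R]_n) j : continuous (fun x : V => (x *m M) 0 j).
Proof.
rewrite (_ : (fun x : V => _) = fun x => \sum_i x 0 i * M i j); last first.
  by apply/funext => x; rewrite mxE.
apply: continuous_big_sum => i x; apply: continuousM; last exact: cst_continuous.
exact: coord_continuous.
Qed.

Lemma continuous_mulmx (M : 'M[R]_n) : continuous (fun x : V => x *m M).
Proof.
move=> x B [P PM sPB].
have h (j : 'I_n) : \forall y \near x, P 0 j ((y *m M) 0 j).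
  exact: (continuous_mulmx_coord (PM 0 j)).
have := filter_forall (nbhs_filter x) h; apply: filterS => y hy.
by apply: sPB => i j; rewrite (ord1 i); exact: hy.
Qed.

Lemma continuous_qf A : continuous (qf A).
Proof.
rewrite (_ : qf A = fun x : V => \sum_j (x *m A) 0 j * x 0 j); last first.
  by apply/funext => x; rewrite /qf mxE; apply: eq_bigr => j _; rewrite [x^T _ _]mxE.
apply: continuous_big_sum => j x; apply: continuousM; last exact: coord_continuous.
exact: continuous_mulmx_coord.
Qed.

Lemma closed_ellip A : closed (ellip A).
Proof.
rewrite (_ : ellip A = qf A @^-1` [set t | t <= 1])//.
by apply: closed_comp; [move=> x _; exact: continuous_qf|exact: closed_le].
Qed.

Lemma boundary_ellip A : boundary (ellip A) = [set x | qf A x = 1].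
Proof.
rewrite /boundary -(closure_id _).1; last exact: closed_ellip.
apply/seteqP; split => x /=.
  move=> [Ax nx]; apply/eqP; rewrite eq_le [_ <= _]Ax leNgt; apply/negP => x1.
  have oU : open (qf A @^-1` [set t | t < 1]).
    by apply: open_comp; [move=> y _; exact: continuous_qf|exact: open_lt].
  have sU : qf A @^-1` [set t | t < 1] `<=` ellip A.
    by move=> y; rewrite /ellip/= => /ltW.
  by move: sU; rewrite open_subsetE// => /(_ x x1).
move=> x1; split; first by rewrite /ellip/= x1.
rewrite /interior /= => /nbhs_ballP[e /= e0 xe].
(* The point [t *: x] lies outside the ellipsoid and within [e] of [x]; adding 1 to the norm keeps
   the denominator positive. *)
pose t := 1 + e / (`|x| + 1) / 2.
have x10 : 0 < `|x| + 1 by rewrite ltr_pwDr.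
have t1 : 1 < t by rewrite /t ltrDl !divr_gt0.
have : ball x e (t *: x).
  rewrite mx_norm_ball /ball_/=.
  have -> : x - t *: x = (1 - t) *: x by rewrite scalerBl scale1r.
  rewrite normrZ distrC gtr0_norm ?subr_gt0// /t addrAC subrr add0r.
  have -> : e / (`|x| + 1) / 2 * `|x| = e * (`|x| / (`|x| + 1) / 2).
    by field; exact: lt0r_neq0.
  rewrite -[ltRHS]mulr1 ltr_pM2l// ltr_pdivrMr// mul1r.
  apply: (@le_lt_trans _ _ 1); last lra.
  by rewrite ler_pdivrMr// mul1r lerDl.
move=> /xe; rewrite /ellip/= qfZ x1 mulr1 => h.
have : 1 < t ^+ 2 by rewrite expr_gt1// ltW// (lt_trans _ t1).
by rewrite ltNge h.
Qed.

Lemma continuous_borel_measurable (D : set (borel_rV R n)) (f : V -> R) :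
  measurable D -> continuous f -> measurable_fun D (f : borel_rV R n -> R).
Proof.
move=> mD cf; apply: (measurability _ (RGenOpens.measurableE R)) => //.
move=> _ [_ [a [b ->]] <-]; apply: measurableI => //.
apply: sub_sigma_algebra; move/continuousP: cf; apply; exact: interval_open.
Qed.

Lemma mulmx_borel_measurable (M : 'M[R]_n) :
  measurable_fun setT ((fun x => x *m M) : borel_rV R n -> borel_rV R n).
Proof.
apply: (@measurability _ _ (borel_rV R n) (borel_rV R n) setT _ (@open V)) => //.
move=> _ [B oB <-]; rewrite setTI; apply: sub_sigma_algebra.
by have /continuousP := @continuous_mulmx M; apply.
Qed.

Lemma measurable_boundary_ellip A :
  measurable (boundary (ellip A) : set (borel_rV R n)).
Proof.
rewrite boundary_ellip.
have -> : [set x : V | qf A x = 1] = ~` (qf A @^-1` (~` [set 1])).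
  by apply/seteqP; split => x; [move=> h nh; exact: nh|exact: contrapT].
apply: measurableC; apply: sub_sigma_algebra.
have /continuousP := @continuous_qf A; apply.
exact/closed_openC/closed_eq.
Qed.

Lemma gauge_ellip A x : posdef A -> gauge (ellip A) x ^+ 2 = qf A x.
Proof.
move=> pA; have q0 := posdef_ge0 x pA; set s := Num.sqrt (qf A x).
suff -> : gauge (ellip A) x = s by rewrite sqr_sqrtr.
rewrite /gauge; set L := [set l | _].
(* The inequality is strict because for [x = 0] the infimum 0 is not attained. *)
have mem l : s < l -> L l.
  move=> sl; have l0 : 0 < l by apply: le_lt_trans sl; exact: sqrtr_ge0.
  split => //; exists (l^-1 *: x); last by rewrite scalerA mulfV ?scale1r// gt_eqF.
  rewrite /ellip/= qfZ exprVn mulrC ler_pdivrMr ?exprn_gt0// mul1r.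
  by rewrite -(sqr_sqrtr q0) ler_pXn2r ?nnegrE ?sqrtr_ge0// ltW.
have lb : lbound L s.
  move=> l [l0 [y + yx]]; rewrite /ellip/= => y1.
  rewrite -(@ler_pXn2r _ 2) ?nnegrE ?sqrtr_ge0 ?(ltW l0)// sqr_sqrtr// -yx qfZ.
  by rewrite ler_piMr// sqr_ge0.
have L0 : L !=set0 by exists (s + 1); apply: mem; rewrite ltrDl.
apply/eqP; rewrite eq_le lb_le_inf// andbT; apply/ler_addgt0Pr => e e0.
by apply: ge_inf; [exists s|apply: mem; rewrite ltrDl].
Qed.

End Topology.

(** * The invariant measure *)

Section Moments.
Context {R : realType} {n : nat}.
Local Notation V := 'rV[R]_n.
Variables (A0 T : 'M[R]_n) (mu : probability (borel_rV R n) R).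
Hypotheses (uT : T \in unitmx) (T1 : T *m A0 *m T^T = 1%:M).
Let D : set (borel_rV R n) := boundary (ellip A0).
Hypothesis muD : mu D = 1%E.
Hypothesis mu_inv : forall M : 'M[R]_n, M *m A0 *m M^T = A0 ->
  forall A : set (borel_rV R n), measurable A -> mu ((fun x => x *m M) @^-1` A) = mu A.

Let mD : measurable D. Proof. exact: measurable_boundary_ellip. Qed.

Let DE x : D x = (qf A0 x = 1).
Proof. by rewrite /D boundary_ellip. Qed.

Lemma bounded_integrable_boundary (f : V -> R) (c : R) : continuous f ->
  (forall x, D x -> `|f x| <= c) -> mu.-integrable D (EFin \o (f : borel_rV R n -> R)).
Proof.
move=> cf fc; apply: measurable_bounded_integrable => //.
- by rewrite -ge0_fin_numE// fin_num_measure.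
- exact: continuous_borel_measurable.
- exists c; split; first exact: num_real.
  by move=> M cM x Dx; apply: le_trans (fc x Dx) (ltW cM).
Qed.

(** Change of variables: the preimage of [D] under [M] is [D], and the image of [mu] under [M] is
    [mu]. *)
Lemma Rintegral_isometry (f : V -> R) (c : R) (M : 'M[R]_n) : continuous f ->
  (forall x, D x -> `|f x| <= c) -> M *m A0 *m M^T = A0 ->
  \int[mu]_(x in D) f (x *m M) = \int[mu]_(x in D) f x.
Proof.
move=> cf fc hM; pose phi (x : borel_rV R n) : borel_rV R n := x *m M.
have mphi : measurable_fun setT phi := @mulmx_borel_measurable R n M.
have phiD : phi @^-1` D = D.
  by apply/seteqP; split => x; rewrite /= !DE /phi -qf_congr hM.
have cfM : continuous (fun x : V => f (x *m M)).
  by move=> x; apply: continuous_comp; [exact: continuous_mulmx|exact: cf].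
congr fine; rewrite -[X in integral _ X _]phiD.
rewrite -[LHS](@integral_pushforward _ _ _ _ R phi mphi mu D (EFin \o (f : borel_rV R n -> R))) //.
- by apply: eq_measure_integral => A mA _; exact: mu_inv.
- by apply/measurable_EFinP; exact: continuous_borel_measurable.
- rewrite phiD; apply: (bounded_integrable_boundary (c := c) cfM) => x Dx.
  by apply: fc; rewrite DE -qf_congr hM -DE.
Qed.

(** Coordinates in the basis formed by the rows of [T], which is orthonormal for [A0]. *)
Definition coords (x : V) : V := x *m invmx T.
Definition moment i j : R := \int[mu]_(x in D) (coords x 0 i * coords x 0 j).

Lemma qf_coords A x : qf A x = qf (T *m A *m T^T) (coords x).
Proof. by rewrite qf_congr mulmxKV. Qed.

Lemma coords_norm x : D x -> \sum_i coords x 0 i ^+ 2 = 1.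
Proof. by rewrite DE qf_coords T1 qf1. Qed.

Lemma coords_le1 x i : D x -> `|coords x 0 i| <= 1.
Proof.
move=> /coords_norm h.
rewrite -(ler_pXn2r (ltn0Sn 1)) ?nnegrE// real_normK ?num_real// expr1n -h.
by rewrite (bigD1 i)//= lerDl sumr_ge0// => j _; exact: sqr_ge0.
Qed.

Lemma continuous_coords i j : continuous (fun x : V => coords x 0 i * coords x 0 j).
Proof. by move=> x; apply: continuousM; exact: continuous_mulmx_coord. Qed.

Lemma coordsM_le1 i j x : D x -> `|coords x 0 i * coords x 0 j| <= 1.
Proof. by move=> Dx; rewrite normrM mulr_ile1// coords_le1. Qed.

(** An orthogonal [S] acting on the coordinates is the map [M] on vectors, which preserves the form
    of [A0]. *)
Lemma moment_orthogonal (S : 'M[R]_n) i j : S *m S^T = 1%:M ->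
  moment i j = \int[mu]_(x in D) ((coords x *m S) 0 i * (coords x *m S) 0 j).
Proof.
move=> hS; pose M := invmx T *m S *m T.
have uTt : T^T \in unitmx by rewrite unitmx_tr.
have hM : M *m A0 *m M^T = A0.
  have -> : M *m A0 *m M^T = invmx T *m (S *m (T *m A0 *m T^T) *m S^T) *m (invmx T)^T.
    by rewrite /M !trmx_mul !mulmxA.
  rewrite T1 mulmx1 hS mulmx1 -[in RHS](mulKmx uT A0) -[in RHS](mulmxK uTt (T *m A0)).
  by rewrite T1 mul1mx trmx_inv.
rewrite /moment -(@Rintegral_isometry _ 1 M (continuous_coords (i:=i) (j:=j))
  (@coordsM_le1 i j) hM).
by apply: eq_Rintegral => x _; rewrite /coords /M !mulmxA mulmxK.
Qed.

(** Changing the sign of coordinate [i] changes the sign of the moment. *)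
Lemma moment_offdiag i j : i != j -> moment i j = 0.
Proof.
move=> ij; pose d : V := \row_k (if k == i then -1 else 1).
have hd : diag_mx d *m (diag_mx d)^T = 1%:M.
  rewrite tr_diag_mx mul_mx_diag; apply/matrixP => a b; rewrite !mxE.
  have [->|] := eqVneq a b; rewrite ?mul0r// mulr1n.
  by case: ifP; rewrite ?mulrNN mulr1.
have : moment i j = - moment i j.
  rewrite {1}(moment_orthogonal i j hd) -[RHS]mulN1r -RintegralZl//; last first.
    exact: (bounded_integrable_boundary (continuous_coords (i:=i) (j:=j)) (@coordsM_le1 i j)).
  apply: eq_Rintegral => x _; rewrite mul_mx_diag !mxE eqxx eq_sym (negbTE ij).
  by ring.
lra.
Qed.

(** Exchange coordinates [i] and [j]. *)
Lemma moment_diag i j : moment i i = moment j j.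
Proof.
have hS : tperm_mx i j *m (tperm_mx i j)^T = 1%:M :> 'M[R]_n.
  by rewrite tr_tperm_mx -perm_mxM perm.tperm2 perm_mx1.
rewrite (moment_orthogonal i i hS); apply: eq_Rintegral => x _.
by rewrite -xcolE mxE perm.tpermL.
Qed.

Lemma Rintegral_sum_boundary (I : Type) (s : seq I) (f : I -> V -> R) (c : I -> R) :
  (forall i, continuous (f i)) -> (forall i x, D x -> `|f i x| <= c i) ->
  \int[mu]_(x in D) (\sum_(i <- s) f i x) = \sum_(i <- s) \int[mu]_(x in D) f i x.
Proof.
move=> cf fc; elim: s => [|i s IH].
  rewrite big_nil; under eq_Rintegral do rewrite big_nil.
  by rewrite Rintegral_cst// mul0r.
rewrite big_cons -IH; under eq_Rintegral do rewrite big_cons.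
apply: RintegralD => //; first exact: bounded_integrable_boundary (fc i).
apply: (@bounded_integrable_boundary _ (\sum_(i <- s) c i)).
  exact: continuous_big_sum.
move=> x Dx; elim: {IH} s => [|k s IH]; first by rewrite !big_nil normr0.
by rewrite !big_cons (le_trans (ler_normD _ _))// lerD// fc.
Qed.

Lemma sum_moment : \sum_i moment i i = 1.
Proof.
rewrite -(@Rintegral_sum_boundary _ _ (fun i x => coords x 0 i * coords x 0 i) (fun=> 1)).
- transitivity (\int[mu]_(x in D) 1).
    by apply: eq_Rintegral => x /set_mem/coords_norm <-.
  by rewrite Rintegral_cst// mul1r; exact: (congr1 fine muD).
- by move=> i; exact: continuous_coords.
- by move=> i x; exact: coordsM_le1.
Qed.

(** In dimension 0 the boundary is empty and cannot have mass 1; this shows here as an empty sum of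
    moments equal to 1. *)
Lemma dimension_gt0 : (0 < n)%N.
Proof.
rewrite lt0n; apply/eqP => n0; have := sum_moment; rewrite big1 => [/esym/eqP|i _].
  by rewrite oner_eq0.
by suff: false by []; rewrite -(ltn0 i) -[X in (_ < X)%N]n0 ltn_ord.
Qed.

Lemma momentE i j : moment i j = (i == j)%:R / n%:R.
Proof.
have [<-|ij] := eqVneq i j; last by rewrite mul0r moment_offdiag.
have : n%:R * moment i i = 1.
  rewrite -[RHS]sum_moment; under eq_bigr do rewrite (moment_diag _ i).
  by rewrite sumr_const card_ord mulr_natl.
move=> h; have nz : n%:R != 0 :> R by rewrite pnatr_eq0 -lt0n dimension_gt0.
by apply: (canRL (mulfK nz)); rewrite mulrC h.
Qed.

(** In orthonormal coordinates the squared gauge is the form of [B]; integration kills its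
    off-diagonal terms and gives each diagonal entry the weight [1 / n]. *)
Lemma Mnorm_sqr A : posdef A ->
  Mnorm (ellip A0) mu (ellip A) ^+ 2 * n%:R = \tr (T *m A *m T^T).
Proof.
move=> pA; rewrite /Mnorm sqr_sqrtr; last first.
  by apply: Rintegral_ge0 => x _; exact: sqr_ge0.
set B := T *m A *m T^T.
pose f (p : 'I_n * 'I_n) x := B p.1 p.2 * (coords x 0 p.1 * coords x 0 p.2).
transitivity ((\int[mu]_(x in D) (\sum_p f p x)) * n%:R).
  congr (_ * _); apply: eq_Rintegral => x _; rewrite gauge_ellip// qf_coords.
  rewrite -(pair_bigA _ (fun i j => f (i, j) x))/= exchange_big/= /qf mxE.
  apply: eq_bigr => j _; rewrite [_^T _ _]mxE mxE mulr_suml; apply: eq_bigr => i _.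
  by rewrite /f/=; ring.
rewrite (@Rintegral_sum_boundary _ _ f (fun p => `|B p.1 p.2|)).
- rewrite -(pair_bigA _ (fun i j => \int[mu]_(x in D) f (i, j) x))/= mulr_suml.
  apply: eq_bigr => i _; rewrite (bigD1 i)//= big1 ?addr0 => [|j ji].
    rewrite /f/= RintegralZl//; last first.
      exact: (bounded_integrable_boundary (continuous_coords (i:=i) (j:=i)) (@coordsM_le1 i i)).
    rewrite -/(moment i i) momentE eqxx -mulrA divfK ?mulr1//.
    by rewrite pnatr_eq0 -lt0n dimension_gt0.
  rewrite /f/= RintegralZl//; last first.
    exact: (bounded_integrable_boundary (continuous_coords (i:=i) (j:=j)) (@coordsM_le1 i j)).
  by rewrite -/(moment i j) moment_offdiag ?mulr0// eq_sym.
- move=> p x; rewrite /f.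
  apply: (@continuousM R V (fun=> B p.1 p.2) (fun y => coords y 0 p.1 * coords y 0 p.2)).
    exact: cst_continuous.
  exact: continuous_coords.
- move=> p x Dx; rewrite /f normrM ler_piMr//; exact: coordsM_le1.
Qed.

End Moments.

(** * The equivalence for a convex body *)

Lemma convex_set_sub0 (R : realType) (V : lmodType R) (K : set V) : convex_set K -> K 0 ->
  forall x y a b, 0 <= a -> 0 <= b -> a + b <= 1 -> K x -> K y -> K (a *: x + b *: y).
Proof.
move=> cK K0 x y a b a0 b0 ab Kx Ky.
have conv u v t : 0 <= t <= 1 -> K u -> K v -> K (t *: u + (1 - t) *: v).
  move=> /andP[t0 t1] Ku Kv.
  exact: set_mem (cK u v (Itv01 t0 t1) (mem_set Ku) (mem_set Kv)).
(* For [a + b > 0] the point is a convex combination of [x] and [y], contracted towards 0 by the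
   factor [a + b]. *)
have [s0|s0] := eqVneq (a + b) 0.
  have a00 : a = 0 by lra.
  have b00 : b = 0 by lra.
  by rewrite a00 b00 !scale0r addr0.
have sp : 0 < a + b by rewrite lt_neqAle eq_sym s0 addr_ge0.
have e : 1 - a / (a + b) = b / (a + b) by field.
have := conv x y (a / (a + b)) _ Kx Ky; rewrite e => Kz.
have := conv _ 0 (a + b) _ (Kz _) K0; rewrite scaler0 addr0 scalerDr !scalerA.
rewrite ![(a + b) * _]mulrC !divfK//; apply.
  by rewrite ab addr_ge0.
by rewrite divr_ge0 ?(ltW sp)// ler_pdivrMr// mul1r lerDl.
Qed.

Lemma ellipsoid_gram (R : realType) (n : nat) (F : set 'rV[R]_n) : ellipsoid F ->
  exists2 A : 'M[R]_n, posdef A & F = ellip A.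
Proof. by move=> [ip ->]; exists (gram ip); [exact: posdef_gram|exact: unit_ball_gram]. Qed.

(** An ellipsoid contains 0, so it cannot be the default value [set0]. *)
Lemma xget_ellipsoid (R : realType) (n : nat) (P : set (set 'rV[R]_n)) E :
  ellipsoid E -> xget set0 P = E -> P E.
Proof.
move=> /ellipsoid_gram[A _ ->]; case: xgetP => [F -> PF <-//|_ e].
by have := ellip0 A; rewrite -e.
Qed.

Theorem mainTheorem3 (R : realType) (n : nat) (K E : set 'rV[R]_n)
    (mu : probability (borel_rV R n) R)
    (hK : body K) (hE : ellipsoid E) (hmu : invariant_probability E mu) :
  u_map K E mu = E <-> E = lowner_john K.
Proof.
have [_ cK _ _] := hK.
have [ip Eip] := hE; have [muD inv] := hmu.
have pA0 := posdef_gram ip; set A0 := gram ip in pA0.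
have EA0 : E = ellip A0 by rewrite Eip unit_ball_gram.
have [T [uT T1]] := posdef_orthonormal pA0.
rewrite EA0 in muD.
have mu_inv (M : 'M[R]_n) : M *m A0 *m M^T = A0 ->
    forall B : set (borel_rV R n), measurable B -> mu ((fun x => x *m M) @^-1` B) = mu B.
  move=> hM B mB; apply: (inv ip Eip (mulmxr M)) => // u v.
  by rewrite /= !gramE trmx_mul -/A0 -[in RHS]hM !mulmxA.
have n0 := dimension_gt0 uT T1 muD.
have nR : 0 < n%:R :> R by rewrite ltr0n.
have ME A : posdef A -> Mnorm E mu (ellip A) ^+ 2 * n%:R = \tr (T *m A *m T^T).
  by rewrite EA0; exact: Mnorm_sqr.
have M0 F : 0 <= Mnorm E mu F by exact: sqrtr_ge0.
have MEE : Mnorm E mu E ^+ 2 * n%:R = n%:R by rewrite {2}EA0 ME// T1 mxtrace1.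
have leM A : posdef A -> (Mnorm E mu E <= Mnorm E mu (ellip A)) = (n%:R <= \tr (T *m A *m T^T)).
  move=> pA; rewrite -(ler_pXn2r (ltn0Sn 1)) ?nnegrE//.
  by rewrite -(ler_pM2r nR) MEE ME.
have lbM : has_lbound [set Mnorm E mu F | F in [set F | ellipsoid F /\ F `<=` K]].
  by exists 0 => _ [F _ <-].
split.
(* If [E] minimizes [M_E], then [A0] minimizes the trace; [K] contains 0 because [E] does. *)
- move=> /(xget_ellipsoid hE) [_ EK EJ].
  have star := convex_set_sub0 cK (EK 0 (eq_ind_r (fun F => F 0) (ellip0 A0) EA0)).
  have tr A : posdef A -> ellip A `<=` K -> n%:R <= \tr (T *m A *m T^T).
    move=> pA AK; rewrite -leM// EJ; apply: ge_inf => //.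
    by exists (ellip A) => //; split => //; exact: ellipsoid_ellip.
  have A0K : ellip A0 `<=` K by rewrite -EA0.
  have uniq := min_trace_max_det star pA0 A0K uT T1 tr.
  apply/esym/xget_unique.
    split => // F /ellipsoid_gram[A pA ->] AK; rewrite EA0 volume_ellip_le//.
    by have /orP[//|/(uniq A pA AK)->] := le_total (\det A0) (\det A).
  (* Another ellipsoid of maximal volume has determinant at most [\det A0], so [uniq] applies. *)
  move=> F [/ellipsoid_gram[A pA ->] AK /(_ E hE EK)].
  by rewrite {1}EA0 volume_ellip_le// => /(uniq A pA AK) ->; rewrite EA0.
- move=> /esym/(xget_ellipsoid hE) [_ EK Emax].
  (* Maximal volume of [E] gives [\det A0 <= \det A], the determinant condition in
     [posdef_trace_det_eq]. *)
  have uniq A : posdef A -> ellip A `<=` K -> \tr (T *m A *m T^T) <= n%:R -> A = A0.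
    move=> pA AK; apply: posdef_trace_det_eq => //.
    rewrite -(volume_ellip_le n0 pA pA0) -EA0; apply: Emax => //; exact: ellipsoid_ellip.
  have EJ : Mnorm E mu E = Jinf K E mu.
    apply/eqP; rewrite eq_le; apply/andP; split; last first.
      by apply: ge_inf => //; exists E.
    apply: lb_le_inf; first by exists (Mnorm E mu E), E.
    move=> _ [F [/ellipsoid_gram[A pA ->] AK] <-]; rewrite leM//.
    by have /orP[//|h] := le_total n%:R (\tr (T *m A *m T^T)); rewrite (uniq A)// T1 mxtrace1.
  (* A second minimizer has the same [M_E] as [E], hence trace exactly [n]. *)
  apply: xget_unique => // F [/ellipsoid_gram[A pA ->] AK]; rewrite -EJ => h.
  by rewrite EA0 (uniq A)// -ME// h MEE.
Qed.
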